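(* Let $X\subseteq\mathbb{R}$. The function $f:X\to\mathbb{C}$ is uniformly continuous on $X$ if and only if ${}^*f(x)\approx{}^*f(r)$ for all $x,r\in{}^*X$ such that $x\approx r$.
   Context: $\mathbb{R}_+$ is the set of positive real numbers and $\mathbb{N}=\{1,2,3,\dots\}$. Fix an ultrafilter $\mathcal{U}$ on $\mathbb{R}_+$ such that $(0,\tfrac1n)\in\mathcal{U}$ for all $n\in\mathbb{N}$. A property of $\varepsilon\in\mathbb{R}_+$ holds almost everywhere (a.e.) if the set of $\varepsilon$ for which it holds belongs to $\mathcal{U}$. For nets $(a_\varepsilon),(b_\varepsilon)\in\mathbb{C}^{\mathbb{R}_+}$ write $(a_\varepsilon)\sim(b_\varepsilon)$ if $a_\varepsilon=b_\varepsilon$ a.e.; $\langle a_\varepsilon\rangle$ is the equivalence class, and ${}^*\mathbb{C}=\mathbb{C}^{\mathbb{R}_+}/\!\sim$ with operations induced pointwise; $\mathbb{C}$ is embedded via constant nets; $|\langle z_\varepsilon\rangle|=\langle|z_\varepsilon|\rangle$. For $S\subseteq\mathbb{C}$, ${}^*S=\{\langle s_\varepsilon\rangle : s_\varepsilon\in S\text{ a.e.}\}$; in particular this defines ${}^*\mathbb{R}$, ordered by $\langle a_\varepsilon\rangle<\langle b_\varepsilon\rangle$ iff $a_\varepsilon<b_\varepsilon$ a.e. For $f:X\to\mathbb{C}$, ${}^*f:{}^*X\to{}^*\mathbb{C}$ is ${}^*f(\langle x_\varepsilon\rangle)=\langle f(x_\varepsilon)\rangle$, where the representative is chosen with $x_\varepsilon\in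 X$ for all $\varepsilon$. $z\in{}^*\mathbb{C}$ is infinitesimal if $|z|<\tfrac1n$ for all $n\in\mathbb{N}$; $a\approx b$ means $a-b$ is infinitesimal. *)

(* Defs.v *)
From HB Require Import structures.
From mathcomp Require Import all_boot all_order all_algebra complex.
From mathcomp Require Import all_classical all_reals all_analysis.

Set Implicit Arguments.
Unset Strict Implicit.
Unset Printing Implicit Defensive.

Import Order.TTheory GRing.Theory Num.Theory numFieldNormedType.Exports.
Local Open Scope classical_set_scope.
Local Open Scope quotient_scope.
Local Open Scope ring_scope.

(* Nets are indexed by {posnum R}, the type of positive real numbers; a
   property holds almost everywhere when [\forall e \near U] it holds, i.e.
   when the set of such e belongs to U. *)
Section Hyper.
Context {R : realType} (U : set_system {posnum R}) {UU : UltraFilter U}.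

Section Quotient.
Variable T : choiceType.
Implicit Types a b c : {posnum R} -> T.

Definition net_eq a b : bool := `[< \forall e \near U, a e = b e >].

Lemma net_eqP a b : reflect (\forall e \near U, a e = b e) (net_eq a b).
Proof. exact: asboolP. Qed.

Lemma net_eq_refl : reflexive net_eq.
Proof. by move=> a; apply/net_eqP; exact: nearW. Qed.

Lemma net_eq_sym : symmetric net_eq.
Proof.
by move=> a b; apply/net_eqP/net_eqP; apply: filterS => e ->.
Qed.

Lemma net_eq_trans : transitive net_eq.
Proof.
move=> b a c /net_eqP ab /net_eqP bc; apply/net_eqP.
by apply: filterS2 ab bc => e -> ->.
Qed.

Canonical net_eq_equiv :=
  EquivRel net_eq net_eq_refl net_eq_sym net_eq_trans.

(* [hyper U R[i]] is *C and [hyper U R] is *R, where R[i] is the complex numbers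
   over R. *)
Definition hyper := {eq_quot net_eq}.

HB.instance Definition _ := Choice.on hyper.
HB.instance Definition _ : EqQuotient _ net_eq hyper := EqQuotient.on hyper.

Definition hclass a : hyper := \pi_hyper a.

Lemma hclassP a b : hclass a = hclass b <-> \forall e \near U, a e = b e.
Proof. by split=> [/eqmodP/net_eqP|/net_eqP/eqmodP]. Qed.

Lemma repr_hclass a : \forall e \near U, repr (hclass a) e = a e.
Proof. by apply/hclassP; rewrite /hclass reprK. Qed.

Definition hconst (t : T) : hyper := hclass (fun=> t).

(* The extension *S of a set S. *)
Definition star (S : set T) : set hyper :=
  [set x | exists2 s, x = hclass s & \forall e \near U, S (s e)].

Lemma star_repr (S : set T) (x : hyper) :
  star S x -> exists s : {posnum R} -> S, x = hclass (fun e => val (s e)).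
Proof.
move=> [s -> Ss]; have [e0 Se0] := filter_ex Ss.
pose t0 : S := SigSub (mem_set Se0).
exists (fun e => insubd t0 (s e)); apply/hclassP.
by apply: filterS Ss => e Se; rewrite /= insubdK //; exact: mem_set.
Qed.

End Quotient.

(* *f for f defined only on S; the representative of x is chosen S-valued at
   every index. [star_funE] gives independence of that choice. *)
Definition star_fun (T V : choiceType) (S : set T) (f : S -> V)
    (x : star S) : hyper V :=
  hclass (f \o projT1 (cid (star_repr (set_valP x)))).

Lemma star_funE (T V : choiceType) (S : set T) (f : S -> V) (x : star S)
    (s : {posnum R} -> S) :
  val x = hclass (fun e => val (s e)) -> star_fun f x = hclass (f \o s).
Proof.
rewrite /star_fun; case: cid => t /= xt; rewrite [LHS]xt => /hclassP ts.
by apply/hclassP; apply: filterS ts => e /val_inj /= ->.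
Qed.

Section Ring.
Variable T : comNzRingType.
Implicit Types x y z : hyper T.

Definition hzero : hyper T := hconst 0.
Definition hone : hyper T := hconst 1.
Definition hopp x : hyper T := hclass (fun e => - repr x e).
Definition hadd x y : hyper T := hclass (fun e => repr x e + repr y e).
Definition hmul x y : hyper T := hclass (fun e => repr x e * repr y e).

Lemma hoppE (a : {posnum R} -> T) :
  hopp (hclass a) = hclass (fun e => - a e).
Proof. by apply/hclassP; apply: filterS (repr_hclass a) => e ->. Qed.

Lemma haddE (a b : {posnum R} -> T) :
  hadd (hclass a) (hclass b) = hclass (fun e => a e + b e).
Proof.
by apply/hclassP; apply: filterS2 (repr_hclass a) (repr_hclass b) => e -> ->.
Qed.

Lemma hmulE (a b : {posnum R} -> T) :
  hmul (hclass a) (hclass b) = hclass (fun e => a e * b e).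
Proof.
by apply/hclassP; apply: filterS2 (repr_hclass a) (repr_hclass b) => e -> ->.
Qed.

Let hyperW (P : hyper T -> Prop) : (forall a, P (hclass a)) -> forall x, P x.
Proof. by move=> Pa x; rewrite -[x]reprK; exact: Pa. Qed.

Let haddA : associative hadd.
Proof.
elim/hyperW=> a; elim/hyperW=> b; elim/hyperW=> c.
by rewrite !haddE; apply/hclassP/nearW => e; rewrite addrA.
Qed.

Let haddC : commutative hadd.
Proof.
elim/hyperW=> a; elim/hyperW=> b.
by rewrite !haddE; apply/hclassP/nearW => e; rewrite addrC.
Qed.

Let hadd0 : left_id hzero hadd.
Proof.
by elim/hyperW=> a; rewrite haddE; apply/hclassP/nearW => e; rewrite add0r.
Qed.

Let haddN : left_inverse hzero hopp hadd.
Proof.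
elim/hyperW=> a; rewrite hoppE haddE.
by apply/hclassP/nearW => e; rewrite addNr.
Qed.

HB.instance Definition _ :=
  GRing.isZmodule.Build (hyper T) haddA haddC hadd0 haddN.

Let hmulA : associative hmul.
Proof.
elim/hyperW=> a; elim/hyperW=> b; elim/hyperW=> c.
by rewrite !hmulE; apply/hclassP/nearW => e; rewrite mulrA.
Qed.

Let hmulC : commutative hmul.
Proof.
elim/hyperW=> a; elim/hyperW=> b.
by rewrite !hmulE; apply/hclassP/nearW => e; rewrite mulrC.
Qed.

Let hmul1 : left_id hone hmul.
Proof.
by elim/hyperW=> a; rewrite hmulE; apply/hclassP/nearW => e; rewrite mul1r.
Qed.

Let hmulDl : left_distributive hmul hadd.
Proof.
elim/hyperW=> a; elim/hyperW=> b; elim/hyperW=> c.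
by rewrite !(haddE, hmulE); apply/hclassP/nearW => e; rewrite mulrDl.
Qed.

Let hone_neq0 : hone != hzero.
Proof.
apply/eqP => /hclassP /filter_ex[e] /eqP.
by rewrite oner_eq0.
Qed.

HB.instance Definition _ :=
  GRing.Zmodule_isComNzRing.Build (hyper T) hmulA hmulC hmul1 hmulDl hone_neq0.

Lemma hclassB (a b : {posnum R} -> T) :
  hclass a - hclass b = hclass (fun e => a e - b e).
Proof.
by rewrite -[LHS]/(hadd (hclass a) (hopp (hclass b))) hoppE haddE.
Qed.

End Ring.

Section Order.
Variable T : numDomainType.
Implicit Types x y : hyper T.

Definition habs x : hyper T := hclass (fun e => `|repr x e|).

(* For T := R[i] the order of T is the partial order extending that of the
   reals, and `|z| is the real modulus seen in R[i], so that comparing [habs x]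
   with a real constant is the comparison of *R. *)
Definition hlt x y : Prop := \forall e \near U, repr x e < repr y e.

Lemma habsE (a : {posnum R} -> T) : habs (hclass a) = hclass (fun e => `|a e|).
Proof. by apply/hclassP; apply: filterS (repr_hclass a) => e ->. Qed.

Lemma hltE (a b : {posnum R} -> T) :
  hlt (hclass a) (hclass b) <-> \forall e \near U, a e < b e.
Proof.
split; first by apply: filterS3 (repr_hclass a) (repr_hclass b) => e -> ->.
by apply: filterS3 (repr_hclass a) (repr_hclass b) => e -> ->.
Qed.

End Order.

Definition infinitesimal (T : numFieldType) (x : hyper T) : Prop :=
  forall n : nat, (0 < n)%N -> hlt (habs x) (hconst n%:R^-1).

Definition hclose (T : numFieldType) (x y : hyper T) : Prop :=
  infinitesimal (x - y).

End Hyper.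

Arguments hyper {R} U {UU} T.
Arguments star {R} U {UU T} S.

(* Main.v *)
(** If d is a modulus of uniform continuity for 1/n, then x - r infinitesimal
    forces |x_e - r_e| < d a.e., hence |f x_e - f r_e| < 1/n a.e. Conversely, if
    uniform continuity fails at 1/n, pick for every index e points x_e, r_e of X
    with |x_e - r_e| < e and |f x_e - f r_e| not below 1/n; as U contains all the
    intervals (0, 1/k), the nets x and r are infinitely close. *)

Require Import Defs.
From mathcomp Require Import all_boot all_order all_algebra complex.
From mathcomp Require Import all_classical all_reals all_analysis.

Import Order.TTheory GRing.Theory Num.Theory numFieldNormedType.Exports.
Local Open Scope classical_set_scope.
Local Open Scope ring_scope.

Lemma exists_invn_lt (R : realType) (e : R) : 0 < e ->
  exists2 n : nat, (0 < n)%N & n%:R^-1 < e.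
Proof. by move=> /ltr_add_invr[k]; rewrite add0r => ke; exists k.+1. Qed.

(** In [R[i]], [0 < e] forces the imaginary part to vanish, so the real Archimedean property
    applies. *)
Lemma exists_invn_ltC (R : realType) (e : R[i]) : 0 < e ->
  exists2 n : nat, (0 < n)%N & n%:R^-1 < e.
Proof.
case: e => a b; rewrite ltcE /= => /andP[/eqP -> /exists_invn_lt[n n0 na]].
by exists n => //; rewrite -(rmorph_nat (real_complex R)) -fmorphV ltcR.
Qed.

(** Balls generate both uniformities, and the Archimedean property lets the radii 1/n replace all
    positive ones. *)
Lemma unif_continuous_natP (R : realType) (X : set R) (f : X -> R[i]) :
  unif_continuous (f : X -> R[i]^o) <->
  forall n : nat, (0 < n)%N -> exists2 m : nat, (0 < m)%N &
    forall x y : X, `|val x - val y| < m%:R^-1 -> `|f x - f y| < n%:R^-1.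
Proof.
have fF : Filter ((fun xy => (f xy.1, f xy.2) : R[i]^o * R[i]^o) @
    (@entourage X)) by exact: fmap_filter.
rewrite /unif_continuous -(@entourage_from_ballE _ R[i]^o) filter_fromP; split.
- move=> uf n n0.
  have /uf : 0 < (n%:R^-1 : R[i]) by rewrite invr_gt0 ltr0n.
  rewrite nbhs_simpl /= -entourage_from_ballE => -[d /= /exists_invn_lt[m m0 md]].
  move=> sub; exists m => // x y xy.
  (* The uniformity of [X] is induced by [val], so its balls unfold to distances in [R]. *)
  by apply: (sub (x, y)); apply: lt_trans md.
- move=> uf e /= /exists_invn_ltC[n n0 ne].
  have [m m0 mf] := uf n n0.
  rewrite nbhs_simpl /= -entourage_from_ballE; exists (m%:R^-1) => /=.
    by rewrite invr_gt0 ltr0n.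
  by move=> [x y] /= xy; apply: lt_trans ne; apply: mf.
Qed.

Lemma hclose_hclassP (R : realType) (U : set_system {posnum R})
    (UU : UltraFilter U) (T : numFieldType) (a b : {posnum R} -> T) :
  hclose (hclass a : hyper U T) (hclass b) <->
  forall n : nat, (0 < n)%N -> \forall e \near U, `|a e - b e| < n%:R^-1.
Proof.
by split=> ab n /ab; rewrite hclassB habsE /hconst hltE.
Qed.

Theorem theorem4p4p1 (R : realType) (U : set_system {posnum R})
    (UU : UltraFilter U)
    (hU : forall n : nat, (0 < n)%N -> \forall e \near U, e%:num < n%:R^-1)
    (X : set R) (f : X -> R[i]) :
  unif_continuous (f : X -> R[i]^o) <->
  (forall x r : star U X, hclose (val x) (val r) ->
     hclose (star_fun f x) (star_fun f r)).
Proof.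
rewrite unif_continuous_natP; split.
- move=> uf x r.
  have [s xs] := star_repr (set_valP x); have [t rt] := star_repr (set_valP r).
  rewrite (star_funE _ xs) (star_funE _ rt) [val x]xs [val r]rt.
  move=> /hclose_hclassP st; apply/hclose_hclassP => n /uf[m m0 mf].
  by apply: filterS (st m m0) => e; exact: mf.
- apply: contraPP => /existsNP[n /not_implyP[n0 nuf]] fclose.
  have bad (e : {posnum R}) : exists xy : X * X,
      `|val xy.1 - val xy.2| < e%:num /\ ~ `|f xy.1 - f xy.2| < n%:R^-1.
    (* Without a bad pair at [e], any [m] with 1/m < [e] would serve as a modulus for 1/n, against
       [nuf]. *)
    apply: contrapT => /forallNP good; apply: nuf.
    have /exists_invn_lt[m m0 me] : 0 < e%:num by [].
    exists m => // x y xy; apply: contrapT => nxy.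
    by apply: (good (x, y)); split=> //; exact: lt_trans me.
  have [g gP] := choice bad.
  have starX (s : {posnum R} -> X) : star U X (hclass (fun e => val (s e))).
    by exists (fun e => val (s e)) => //; apply: nearW => e; exact: set_valP.
  pose x : star U X := SigSub (mem_set (starX (fun e => (g e).1))).
  pose r : star U X := SigSub (mem_set (starX (fun e => (g e).2))).
  have /fclose : hclose (val x) (val r).
    apply/hclose_hclassP => k k0.
    by apply: filterS (hU k k0) => e; apply: lt_trans; have [] := gP e.
  (* Both components of [g] take values in [X] at every index, so they may replace the
     representatives chosen in [star_fun]. *)
  rewrite (@star_funE _ _ _ _ _ _ f x (fun e => (g e).1)) //.
  rewrite (@star_funE _ _ _ _ _ _ f r (fun e => (g e).2)) //.
  (* Sets in the proper filter [U] are nonempty, so one index with [f]-values closer than 1/n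
     already contradicts [gP]. *)
  by move=> /hclose_hclassP /(_ n n0) /filter_ex[e]; have [] := gP e.
Qed.
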